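(* Let $C$ be a 3-monoidal category with monoidal structures $\otimes_h,\otimes_v,\otimes_d$ and common unit object $1$, and consider the braiding $\gamma$ on the monoidal category $(C,\otimes_h,1,\alpha^h,l,r)$ whose component at objects $a,b$ of $C$ is the composite of isomorphisms $$\gamma_{a,b}:\quad a\otimes_h b \xrightarrow{\ \beta_a^{-1}\otimes_h\tau_b^{-1}\ } (a\otimes_v 1)\otimes_h(1\otimes_v b) = (a\otimes_h 1)\otimes_v(1\otimes_h b)\xrightarrow{\ r_a\otimes_v l_b\ } a\otimes_v b \xrightarrow{\ l_a^{-1}\otimes_v r_b^{-1}\ } (1\otimes_h a)\otimes_v(b\otimes_h 1) = (1\otimes_v b)\otimes_h(a\otimes_v 1)\xrightarrow{\ \tau_b\otimes_h\beta_a\ } b\otimes_h a .$$ Then this braiding is a symmetry, i.e. $\gamma_{b,a}\circ\gamma_{a,b}=\mathrm{id}_{a\otimes_h b}$ for all objects $a,b$ of $C$.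
   Context: A (semi-strict) 2-monoidal category is a category $A$ equipped with two (weak) monoidal structures, $(\otimes_v,V,\alpha^v,\tau,\beta)$ and $(\otimes_h,H,\alpha^h,l,r)$, where $\alpha^v,\alpha^h$ are the associativity isomorphisms (in the direction $(x\otimes y)\otimes z\to x\otimes(y\otimes z)$) and the unit isomorphisms are $\tau_a:V\otimes_v a\to a$, $\beta_a:a\otimes_v V\to a$, $l_a:H\otimes_h a\to a$, $r_a:a\otimes_h H\to a$, satisfying the following for all objects $a,b,c,d,e,f$: (1) $V=H$ (this common unit is written $1$), $H\otimes_v H=H$, $\alpha^v_{H,H,H}=\mathrm{id}$, $\beta_H=\mathrm{id}$, $\tau_H=\mathrm{id}$; (2) strict interchange: $(a\otimes_h b)\otimes_v(c\otimes_h d)=(a\otimes_v c)\otimes_h(b\otimes_v d)$, on objects and on morphisms; $V\otimes_h V=V$; $\alpha^v_{a\otimes_h b,\,c\otimes_h d,\,e\otimes_h f}=\alpha^v_{a,c,e}\otimes_h\alpha^v_{b,d,f}$; $\beta_{a\otimes_h b}=\beta_a\otimes_h\beta_b$; $\tau_{a\otimes_h b}=\tau_a\otimes_h\tau_b$; (3) $\alpha^h_{a,b,c}\otimes_v\alpha^h_{d,e,f}=\alpha^h_{a\otimes_v d,\,b\otimes_v e,\,c\otimes_v f}$; $l_a\otimes_v l_b=l_{a\otimes_v b}$; $r_a\otimes_v r_b=r_{a\otimes_v b}$; $\alpha^h_{V,V,V}=\mathrm{id}$; $l_V=\mathrm{id}$; $r_V=\mathrm{id}$. (Here equations between morphisms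 use the equalities of objects given by interchange and the unit equalities.) A 3-monoidal category is a category $C$ equipped with three monoidal structures $\otimes_h,\otimes_v,\otimes_d$, any two of which form a 2-monoidal category. In particular the three units coincide. The unit isomorphisms of $\otimes_h$ are written $l_a:1\otimes_h a\to a$ and $r_a:a\otimes_h 1\to a$, and those of $\otimes_v$ are written $\tau_a:1\otimes_v a\to a$ and $\beta_a:a\otimes_v 1\to a$. The family $\gamma$ in the claim is known to be a braiding on $(C,\otimes_h,1)$. *)

(* Defs.v *)
Set Implicit Arguments.
Unset Strict Implicit.
Unset Printing Implicit Defensive.

Record Category : Type := {
  Obj :> Type;
  Hom : Obj -> Obj -> Type;
  idm : forall a : Obj, Hom a a;
  comp : forall a b c : Obj, Hom b c -> Hom a b -> Hom a c;
  comp_idl : forall (a b : Obj) (f : Hom a b), comp (idm b) f = f;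
  comp_idr : forall (a b : Obj) (f : Hom a b), comp f (idm a) = f;
  comp_assoc : forall (a b c d : Obj)
      (h : Hom c d) (g : Hom b c) (f : Hom a b),
      comp h (comp g f) = comp (comp h g) f
}.

Arguments Hom {c} a b : rename.
Arguments idm {c} a : rename.
Arguments comp {c a b c0} g f : rename.

Notation "g ∘ f" := (comp g f) (at level 40, left associativity).

Record Iso (C : Category) (a b : C) : Type := {
  iso_hom :> Hom a b;
  iso_inv : Hom b a;
  iso_hom_inv : iso_hom ∘ iso_inv = idm b;
  iso_inv_hom : iso_inv ∘ iso_hom = idm a
}.

Notation "f ^-1" := (iso_inv f) (at level 3, left associativity, format "f ^-1").

(* The identity morphism between two equal objects. *)
Definition eq_to_hom (C : Category) (a b : C) (e : a = b) : Hom a b :=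
  match e in _ = b' return Hom a b' with eq_refl => idm a end.

(* Equality of arrows with their source and target, as in a set of all arrows:
   it requires the sources to be equal, the targets to be equal, and the
   morphisms to agree along these equalities.  No particular proofs of the
   equalities of objects are named: by uniqueness of identity proofs they do
   not matter, and for parallel morphisms the relation is ordinary equality. *)
Inductive arr_eq (C : Category) (a b : C) (f : Hom a b) :
    forall a' b' : C, Hom a' b' -> Prop :=
  arr_eq_refl : arr_eq f f.

Notation "f ≡ g" := (arr_eq f g) (at level 70, no associativity).

(* The unit object is a parameter rather than a field, so that several monoidal
   structures with a common unit can be considered on the same category. *)
Record Monoidal (C : Category) (I : C) : Type := {
  tens : C -> C -> C;
  tens_hom : forall a a' b b' : C,
      Hom a a' -> Hom b b' -> Hom (tens a b) (tens a' b');
  tens_id : forall a b : C, tens_hom (idm a) (idm b) = idm (tens a b);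
  tens_comp : forall (a a' a'' b b' b'' : C)
      (f' : Hom a' a'') (f : Hom a a') (g' : Hom b' b'') (g : Hom b b'),
      tens_hom (f' ∘ f) (g' ∘ g) = tens_hom f' g' ∘ tens_hom f g;
  assoc : forall a b c : C, Iso (tens (tens a b) c) (tens a (tens b c));
  lunit : forall a : C, Iso (tens I a) a;
  runit : forall a : C, Iso (tens a I) a;
  assoc_natural : forall (a a' b b' c c' : C)
      (f : Hom a a') (g : Hom b b') (h : Hom c c'),
      assoc a' b' c' ∘ tens_hom (tens_hom f g) h
      = tens_hom f (tens_hom g h) ∘ assoc a b c;
  lunit_natural : forall (a a' : C) (f : Hom a a'),
      lunit a' ∘ tens_hom (idm I) f = f ∘ lunit a;
  runit_natural : forall (a a' : C) (f : Hom a a'),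
      runit a' ∘ tens_hom f (idm I) = f ∘ runit a;
  pentagon : forall a b c d : C,
      assoc a b (tens c d) ∘ assoc (tens a b) c d
      = tens_hom (idm a) (assoc b c d)
        ∘ assoc a (tens b c) d
        ∘ tens_hom (assoc a b c) (idm d);
  triangle : forall a b : C,
      tens_hom (idm a) (lunit b) ∘ assoc a I b = tens_hom (runit a) (idm b)
}.

Notation "a ⊗[ M ] b" := (tens M a b)
  (at level 40, left associativity, format "a  ⊗[ M ]  b").
Notation "f ⊠[ M ] g" := (tens_hom M f g)
  (at level 40, left associativity, format "f  ⊠[ M ]  g").

(* [lunit v], [runit v] are τ, β and [lunit h], [runit h] are l, r.
   The condition V = H is the sharing of the unit [I]. *)
Record TwoMonoidal (C : Category) (I : C) (v h : Monoidal I) : Prop := {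
  unit_v : I ⊗[v] I = I;
  assoc_v_unit : assoc v I I I ≡ idm I;
  runit_v_unit : runit v I ≡ idm I;
  lunit_v_unit : lunit v I ≡ idm I;

  interchange : forall a b c d : C,
      (a ⊗[h] b) ⊗[v] (c ⊗[h] d) = (a ⊗[v] c) ⊗[h] (b ⊗[v] d);
  interchange_hom : forall (a a' b b' c c' d d' : C)
      (f : Hom a a') (g : Hom b b') (p : Hom c c') (q : Hom d d'),
      (f ⊠[h] g) ⊠[v] (p ⊠[h] q) ≡ (f ⊠[v] p) ⊠[h] (g ⊠[v] q);
  unit_h : I ⊗[h] I = I;
  assoc_v_tens_h : forall a b c d e f : C,
      assoc v (a ⊗[h] b) (c ⊗[h] d) (e ⊗[h] f)
      ≡ assoc v a c e ⊠[h] assoc v b d f;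
  runit_v_tens_h : forall a b : C,
      runit v (a ⊗[h] b) ≡ runit v a ⊠[h] runit v b;
  lunit_v_tens_h : forall a b : C,
      lunit v (a ⊗[h] b) ≡ lunit v a ⊠[h] lunit v b;

  assoc_h_tens_v : forall a b c d e f : C,
      assoc h a b c ⊠[v] assoc h d e f
      ≡ assoc h (a ⊗[v] d) (b ⊗[v] e) (c ⊗[v] f);
  lunit_h_tens_v : forall a b : C,
      lunit h a ⊠[v] lunit h b ≡ lunit h (a ⊗[v] b);
  runit_h_tens_v : forall a b : C,
      runit h a ⊠[v] runit h b ≡ runit h (a ⊗[v] b);
  assoc_h_unit : assoc h I I I ≡ idm I;
  lunit_h_unit : lunit h I ≡ idm I;
  runit_h_unit : runit h I ≡ idm I
}.

Lemma arr_eq_sym (C : Category) (a b a' b' : C) (f : Hom a b) (g : Hom a' b') :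
  f ≡ g -> g ≡ f.
Proof. intros []; constructor. Qed.

Lemma TwoMonoidal_sym (C : Category) (I : C) (v h : Monoidal I) :
  TwoMonoidal v h -> TwoMonoidal h v.
Proof.
intros []; constructor; intros;
  solve [ assumption | symmetry; auto | apply arr_eq_sym; auto ].
Qed.

(* The order within each pair below is immaterial by [TwoMonoidal_sym]. *)
Record ThreeMonoidalCategory : Type := {
  tm_cat :> Category;
  tm_unit : tm_cat;
  tm_h : Monoidal tm_unit;
  tm_v : Monoidal tm_unit;
  tm_d : Monoidal tm_unit;
  tm_vh : TwoMonoidal tm_v tm_h;
  tm_dh : TwoMonoidal tm_d tm_h;
  tm_dv : TwoMonoidal tm_d tm_v
}.

Definition two_monoidal_braiding (C : Category) (I : C) (v h : Monoidal I)
    (T : TwoMonoidal v h) (a b : C) : Hom (a ⊗[h] b) (b ⊗[h] a) :=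
  (lunit v b ⊠[h] runit v a)
  ∘ (eq_to_hom (interchange T I a b I)
     : Hom ((I ⊗[h] a) ⊗[v] (b ⊗[h] I)) ((I ⊗[v] b) ⊗[h] (a ⊗[v] I)))
  ∘ ((lunit h a)^-1 ⊠[v] (runit h b)^-1)
  ∘ (runit h a ⊠[v] lunit h b)
  ∘ (eq_to_hom (eq_sym (interchange T a I I b))
     : Hom ((a ⊗[v] I) ⊗[h] (I ⊗[v] b)) ((a ⊗[h] I) ⊗[v] (I ⊗[h] b)))
  ∘ ((runit v a)^-1 ⊠[h] (lunit v b)^-1).

Definition gamma (C : ThreeMonoidalCategory) (a b : C) :
    Hom (a ⊗[tm_h C] b) (b ⊗[tm_h C] a) :=
  two_monoidal_braiding (tm_vh C) a b.

(* Main.v *)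
From Stdlib Require Import Eqdep.
Require Import Defs.

(** Think of the six objects a⊗b and b⊗a, formed with each of the three tensor
    products, as the vertices of an octahedron, a product being antipodal to
    its reverse.  Two vertices that are not antipodal come from two distinct
    directions of composition; placing a and b at opposite corners of a
    2 × 2 square with units in the other two corners and reading the square in
    its two ways gives an isomorphism between them, the edge of the octahedron
    ([quarter_turn]).  The braiding γ is a path of two edges from a⊗_h b through
    a⊗_v b to the antipode b⊗_h a, and γ_{b,a} ∘ γ_{a,b} is the closed path that
    continues through b⊗_v a: the equator not containing the direction d.

    This loop does not contract within the equator, but it does on the sphere,
    because the triangular faces commute ([quarter_turn_face]).  A face
    is a choice of signs of the three directions, and it commutes because a and
    b may be placed at opposite corners of a 2 × 2 × 2 cube with units in the
    other six corners.  All readings of the cube are the same object, and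
    collapsing its units yields compatible isomorphisms from it to the three
    vertices of the face ([quarter_turn_cube_collapse]).  Going over a⊗_d b,
    the faces turn each of the two halves of the loop into a path through
    a⊗_d b, and these two paths are inverse to each other.

    Only the tensor products and their units enter, so the argument is carried
    out for bifunctors with unit isomorphisms; unlike interchanging monoidal
    structures, these are visibly stable under reversal of a product, and so a
    single computation serves all faces. *)

Set Implicit Arguments.
Unset Strict Implicit.
Unset Printing Implicit Defensive.

(** * Equality of arrows with varying source and target *)

Section ArrowEquality.

Variable C : Category.

Lemma arr_eq_trans (a b a' b' a'' b'' : C)
    (f : Hom a b) (g : Hom a' b') (h : Hom a'' b'') :
  f ≡ g -> g ≡ h -> f ≡ h.
Proof. intros fg gh; destruct gh; exact fg. Qed.

Lemma eq_arr_eq (a b : C) (f g : Hom a b) : f = g -> f ≡ g.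
Proof. intros []; constructor. Qed.

(** This is where uniqueness of identity proofs for objects is needed: an
    equality of arrows may hold along nontrivial loops of objects. *)
Lemma arr_eq_eq (a b : C) (f g : Hom a b) : f ≡ g -> f = g.
Proof.
intros fg.
assert (pairs : existT (fun x => {y : C & Hom x y}) a (existT (Hom a) b f)
              = existT (fun x => {y : C & Hom x y}) a (existT (Hom a) b g)).
{ destruct fg; reflexivity. }
apply inj_pair2 in pairs; apply inj_pair2 in pairs; exact pairs.
Qed.

Lemma arr_eq_dom (a b a' b' : C) (f : Hom a b) (g : Hom a' b') :
  f ≡ g -> a = a'.
Proof. intros []; reflexivity. Qed.

Lemma arr_eq_cod (a b a' b' : C) (f : Hom a b) (g : Hom a' b') :
  f ≡ g -> b = b'.
Proof. intros []; reflexivity. Qed.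

Lemma comp_arr_eq (a b c a' b' c' : C)
    (g : Hom b c) (f : Hom a b) (g' : Hom b' c') (f' : Hom a' b') :
  g ≡ g' -> f ≡ f' -> g ∘ f ≡ g' ∘ f'.
Proof.
intros gg ff.
pose proof (arr_eq_dom ff) as ea.
pose proof (arr_eq_cod ff) as eb.
pose proof (arr_eq_cod gg) as ec.
subst a' b' c'.
rewrite (arr_eq_eq gg), (arr_eq_eq ff); constructor.
Qed.

Lemma eq_to_hom_comp_arr_eq (a b c : C) (e : b = c) (f : Hom a b) :
  eq_to_hom e ∘ f ≡ f.
Proof. destruct e; apply eq_arr_eq, comp_idl. Qed.

Lemma eq_to_hom_irrelevant (a b : C) (e e' : a = b) :
  eq_to_hom e = eq_to_hom e'.
Proof. rewrite (UIP _ _ _ e e'); reflexivity. Qed.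

Lemma eq_to_hom_comp_inverse (a b : C) (e : a = b) (e' : b = a) :
  eq_to_hom e' ∘ eq_to_hom e = idm a.
Proof. destruct e; rewrite (UIP_refl _ _ e'); apply comp_idl. Qed.

Lemma split_epi_cancel (a b c : C) (f g : Hom b c) (u : Hom a b) (s : Hom b a) :
  u ∘ s = idm b -> f ∘ u = g ∘ u -> f = g.
Proof.
intros us fg.
rewrite <- (comp_idr f), <- (comp_idr g), <- us, !comp_assoc, fg; reflexivity.
Qed.

Lemma iso_comp_hom_inv (a b c : C) (g : Iso b c) (f : Iso a b) :
  (g ∘ f) ∘ (f^-1 ∘ g^-1) = idm c.
Proof.
rewrite <- comp_assoc, (comp_assoc f), iso_hom_inv, comp_idl.
apply iso_hom_inv.
Qed.

End ArrowEquality.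

(** * Unital tensor products and their reversal *)

Record UnitalTensor (C : Category) (I : C) : Type := {
  utens : C -> C -> C;
  utens_hom : forall a a' b b' : C,
      Hom a a' -> Hom b b' -> Hom (utens a b) (utens a' b');
  utens_id : forall a b : C, utens_hom (idm a) (idm b) = idm (utens a b);
  utens_comp : forall (a a' a'' b b' b'' : C)
      (f' : Hom a' a'') (f : Hom a a') (g' : Hom b' b'') (g : Hom b b'),
      utens_hom (f' ∘ f) (g' ∘ g) = utens_hom f' g' ∘ utens_hom f g;
  ulunit : forall a : C, Iso (utens I a) a;
  urunit : forall a : C, Iso (utens a I) a;
  ulunit_natural : forall (a a' : C) (f : Hom a a'),
      ulunit a' ∘ utens_hom (idm I) f = f ∘ ulunit a;
  urunit_natural : forall (a a' : C) (f : Hom a a'),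
      urunit a' ∘ utens_hom f (idm I) = f ∘ urunit a
}.

Notation "a ⊙[ p ] b" := (utens p a b)
  (at level 40, left associativity, format "a  ⊙[ p ]  b").
Notation "f ⊡[ p ] g" := (utens_hom p f g)
  (at level 40, left associativity, format "f  ⊡[ p ]  g").

Definition forget_assoc (C : Category) (I : C) (m : Monoidal I) :
    UnitalTensor I :=
  {| utens := tens m;
     utens_hom := tens_hom m;
     utens_id := tens_id m;
     utens_comp := tens_comp m;
     ulunit := lunit m;
     urunit := runit m;
     ulunit_natural := lunit_natural m;
     urunit_natural := runit_natural m |}.

Definition reverse (C : Category) (I : C) (p : UnitalTensor I) :
    UnitalTensor I :=
  {| utens a b := b ⊙[p] a;
     utens_hom a a' b b' f g := g ⊡[p] f;
     utens_id a b := utens_id p b a;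
     utens_comp a a' a'' b b' b'' f' f g' g := utens_comp p g' g f' f;
     ulunit := urunit p;
     urunit := ulunit p;
     ulunit_natural := urunit_natural p;
     urunit_natural := ulunit_natural p |}.

Record Interchange (C : Category) (I : C) (p q : UnitalTensor I) : Prop := {
  inter_obj : forall a b c d : C,
      (a ⊙[q] b) ⊙[p] (c ⊙[q] d) = (a ⊙[p] c) ⊙[q] (b ⊙[p] d);
  inter_hom : forall (a a' b b' c c' d d' : C)
      (f : Hom a a') (g : Hom b b') (s : Hom c c') (t : Hom d d'),
      (f ⊡[q] g) ⊡[p] (s ⊡[q] t) ≡ (f ⊡[p] s) ⊡[q] (g ⊡[p] t);
  inter_lunit_unit_l : ulunit p I ≡ idm I;
  inter_runit_unit_l : urunit p I ≡ idm I;
  inter_lunit_unit_r : ulunit q I ≡ idm I;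
  inter_runit_unit_r : urunit q I ≡ idm I;
  inter_lunit_l : forall a b : C,
      ulunit p (a ⊙[q] b) ≡ ulunit p a ⊡[q] ulunit p b;
  inter_runit_l : forall a b : C,
      urunit p (a ⊙[q] b) ≡ urunit p a ⊡[q] urunit p b;
  inter_lunit_r : forall a b : C,
      ulunit q (a ⊙[p] b) ≡ ulunit q a ⊡[p] ulunit q b;
  inter_runit_r : forall a b : C,
      urunit q (a ⊙[p] b) ≡ urunit q a ⊡[p] urunit q b
}.

Lemma two_monoidal_interchange (C : Category) (I : C) (v h : Monoidal I) :
  TwoMonoidal v h -> Interchange (forget_assoc v) (forget_assoc h).
Proof.
intros []; constructor; simpl; intros;
  solve [ auto | apply arr_eq_sym; auto ].
Qed.

Section UnitalTensors.

Variables (C : Category) (I : C).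
Implicit Types p q r : UnitalTensor I.

Lemma Interchange_sym p q : Interchange p q -> Interchange q p.
Proof.
intros []; constructor; intros;
  solve [ auto | symmetry; auto | apply arr_eq_sym; auto ].
Qed.

Lemma Interchange_reverse_r p q : Interchange p q -> Interchange p (reverse q).
Proof. intros []; constructor; simpl; intros; auto. Qed.

Lemma Interchange_reverse_l p q : Interchange p q -> Interchange (reverse p) q.
Proof.
intros pq; apply Interchange_sym, Interchange_reverse_r, Interchange_sym, pq.
Qed.

Lemma utens_hom_arr_eq p (a a' b b' x x' y y' : C)
    (f : Hom a a') (g : Hom b b') (f' : Hom x x') (g' : Hom y y') :
  f ≡ f' -> g ≡ g' -> f ⊡[p] g ≡ f' ⊡[p] g'.
Proof. intros [] []; constructor. Qed.

Lemma utens_hom_inverse p (a a' b b' : C)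
    (f : Hom a a') (f' : Hom a' a) (g : Hom b b') (g' : Hom b' b) :
  f' ∘ f = idm a -> g' ∘ g = idm b ->
  (f' ⊡[p] g') ∘ (f ⊡[p] g) = idm (a ⊙[p] b).
Proof. intros ff gg; rewrite <- utens_comp, ff, gg; apply utens_id. Qed.

(** * Quarter turns *)

(** The square has rows [a], [I] and [I], [b]. *)
Definition quarter_turn p q (pq : Interchange p q) (a b : C) :
    Hom (a ⊙[p] b) (a ⊙[q] b) :=
  (urunit p a ⊡[q] ulunit p b)
  ∘ (eq_to_hom (inter_obj pq a I I b)
     : Hom ((a ⊙[q] I) ⊙[p] (I ⊙[q] b)) ((a ⊙[p] I) ⊙[q] (I ⊙[p] b)))
  ∘ ((urunit q a)^-1 ⊡[p] (ulunit q b)^-1).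

(** Both turns read the same square, in opposite directions. *)
Lemma quarter_turn_inverse p q (pq : Interchange p q) (qp : Interchange q p)
    (a b : C) :
  quarter_turn qp a b ∘ quarter_turn pq a b = idm (a ⊙[p] b).
Proof.
unfold quarter_turn.
rewrite !comp_assoc.
rewrite <- (comp_assoc _ (_ ⊡[q] _) (_ ⊡[q] _)).
rewrite utens_hom_inverse by apply iso_inv_hom.
rewrite comp_idr.
rewrite <- (comp_assoc _ (eq_to_hom _) (eq_to_hom _)).
rewrite eq_to_hom_comp_inverse, comp_idr.
apply utens_hom_inverse; apply iso_hom_inv.
Qed.

(** * Collapsing the units of a cube *)

(** The compatibility axiom rewrites [urunit r (a ⊙[q] I)] as
    [urunit r a ⊡[q] idm I], after which this is naturality of [urunit q]. *)
Lemma urunit_urunit q r (qr : Interchange q r) (a : C) :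
  urunit q a ∘ urunit r (a ⊙[q] I) ≡ urunit r a ∘ urunit q (a ⊙[r] I).
Proof.
rewrite <- (urunit_natural q (urunit r a)).
apply comp_arr_eq; [ constructor | ].
apply (arr_eq_trans (inter_runit_r qr a I)).
apply utens_hom_arr_eq; [ constructor | apply (inter_runit_unit_r qr) ].
Qed.

Lemma ulunit_ulunit q r (qr : Interchange q r) (b : C) :
  ulunit q b ∘ ulunit r (I ⊙[q] b) ≡ ulunit r b ∘ ulunit q (I ⊙[r] b).
Proof.
rewrite <- (ulunit_natural q (ulunit r b)).
apply comp_arr_eq; [ constructor | ].
apply (arr_eq_trans (inter_lunit_r qr I b)).
apply utens_hom_arr_eq; [ apply (inter_lunit_unit_r qr) | constructor ].
Qed.

(** Of the eight corners of the cube, the four on the side of [a] in the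
    direction [p] make up the left factor of the source, the product of two
    units having been replaced by a unit. *)
Definition cube_collapse p q r (a b : C) :
    Hom (((a ⊙[q] I) ⊙[r] I) ⊙[p] (I ⊙[r] (I ⊙[q] b))) (a ⊙[p] b) :=
  (urunit q a ∘ urunit r (a ⊙[q] I)) ⊡[p] (ulunit q b ∘ ulunit r (I ⊙[q] b)).

Lemma cube_collapse_swap p q r (qr : Interchange q r) (a b : C) :
  cube_collapse p q r a b ≡ cube_collapse p r q a b.
Proof.
apply utens_hom_arr_eq; [ apply urunit_urunit | apply ulunit_ulunit ]; exact qr.
Qed.

Lemma cube_collapse_split_epi p q r (a b : C) :
  exists s, cube_collapse p q r a b ∘ s = idm (a ⊙[p] b).
Proof.
exists (((urunit r (a ⊙[q] I))^-1 ∘ (urunit q a)^-1)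
        ⊡[p] ((ulunit r (I ⊙[q] b))^-1 ∘ (ulunit q b)^-1)).
apply utens_hom_inverse; apply iso_comp_hom_inv.
Qed.

(** Collapsing the cube in the direction [r] leaves a square; by the
    compatibility axioms this is the square of [f ⊡ idm I] and [idm I ⊡ g],
    for [f] and [g] unit isomorphisms of [r], to which interchange applies. *)
Lemma collapse_to_square p q r (pq : Interchange p q) (pr : Interchange p r)
    (qr : Interchange q r) (a b : C) :
  urunit r (a ⊙[q] I) ⊡[p] ulunit r (I ⊙[q] b)
  ≡ urunit r (a ⊙[p] I) ⊡[q] ulunit r (I ⊙[p] b).
Proof.
assert (reduce : forall m n : UnitalTensor I, Interchange n r ->
  urunit r (a ⊙[n] I) ⊡[m] ulunit r (I ⊙[n] b)
  ≡ (urunit r a ⊡[n] idm I) ⊡[m] (idm I ⊡[n] ulunit r b)).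
{ intros m n nr; apply utens_hom_arr_eq.
  - apply (arr_eq_trans (inter_runit_r nr a I)).
    apply utens_hom_arr_eq; [ constructor | apply (inter_runit_unit_r nr) ].
  - apply (arr_eq_trans (inter_lunit_r nr I b)).
    apply utens_hom_arr_eq; [ apply (inter_lunit_unit_r nr) | constructor ]. }
apply (arr_eq_trans (reduce p q qr)).
apply (arr_eq_trans (inter_hom pq _ _ _ _)).
apply arr_eq_sym, (reduce q p pr).
Qed.

(** The outer collapse in the direction [q] cancels against the first half of
    the quarter turn; what is left over the second half is
    [collapse_to_square]. *)
Lemma quarter_turn_cube_collapse p q r (pq : Interchange p q)
    (pr : Interchange p r) (qr : Interchange q r) (a b : C) :
  quarter_turn pq a b ∘ cube_collapse p q r a b ≡ cube_collapse q p r a b.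
Proof.
unfold quarter_turn, cube_collapse.
rewrite !utens_comp, comp_assoc.
rewrite <- (comp_assoc _ (_^-1 ⊡[p] _^-1)).
rewrite utens_hom_inverse by apply iso_inv_hom.
rewrite comp_idr, <- comp_assoc.
apply comp_arr_eq; [ constructor | ].
apply (arr_eq_trans (eq_to_hom_comp_arr_eq _ _)).
apply collapse_to_square; assumption.
Qed.

(** Both sides carry one collapse of the cube to another, and collapses are
    epimorphisms. *)
Lemma quarter_turn_face p q r (pq : Interchange p q) (qr : Interchange q r)
    (pr : Interchange p r) (a b : C) :
  quarter_turn qr a b ∘ quarter_turn pq a b = quarter_turn pr a b.
Proof.
destruct (cube_collapse_split_epi p q r a b) as [s cs].
apply (split_epi_cancel cs), arr_eq_eq.
apply arr_eq_trans with (g := cube_collapse r p q a b).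
- rewrite <- comp_assoc.
  apply arr_eq_trans with (g := quarter_turn qr a b ∘ cube_collapse q r p a b).
  + apply comp_arr_eq; [ constructor | ].
    apply (arr_eq_trans (quarter_turn_cube_collapse pq pr qr a b)).
    apply cube_collapse_swap, pr.
  + apply (arr_eq_trans (quarter_turn_cube_collapse qr
      (Interchange_sym pq) (Interchange_sym pr) a b)).
    apply cube_collapse_swap, Interchange_sym, pq.
- apply arr_eq_sym.
  apply arr_eq_trans with (g := quarter_turn pr a b ∘ cube_collapse p r q a b).
  + apply comp_arr_eq; [ constructor | apply cube_collapse_swap, qr ].
  + apply (quarter_turn_cube_collapse pr pq (Interchange_sym qr) a b).
Qed.

(** Paths of length two between antipodal vertices are homotopic across the two
    faces that share the edge from [q] to [q']. *)
Lemma quarter_turn_path p q q' r (pq : Interchange p q) (qr : Interchange q r)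
    (pq' : Interchange p q') (q'r : Interchange q' r) (qq' : Interchange q q')
    (a b : C) :
  quarter_turn qr a b ∘ quarter_turn pq a b
  = quarter_turn q'r a b ∘ quarter_turn pq' a b.
Proof.
rewrite <- (quarter_turn_face qq' q'r qr), <- (quarter_turn_face pq qq' pq').
apply eq_sym, comp_assoc.
Qed.

End UnitalTensors.

(** * The braiding *)

(** The two sides differ in the bracketing of the composite and in the proofs
    of the equalities of objects. *)
Lemma two_monoidal_braiding_quarter_turns (C : Category) (I : C)
    (v h : Monoidal I) (T : TwoMonoidal v h)
    (hv : Interchange (forget_assoc h) (forget_assoc v))
    (vh' : Interchange (forget_assoc v) (reverse (forget_assoc h))) (a b : C) :
  two_monoidal_braiding T a b = quarter_turn vh' a b ∘ quarter_turn hv a b.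
Proof.
unfold two_monoidal_braiding, quarter_turn; simpl.
rewrite !comp_assoc.
rewrite (eq_to_hom_irrelevant (interchange T I a b I) (inter_obj vh' a I I b)).
rewrite (eq_to_hom_irrelevant (eq_sym (interchange T a I I b))
           (inter_obj hv a I I b)).
reflexivity.
Qed.

(** Reversing both products exchanges the roles of [a] and [b]. *)
Lemma two_monoidal_braiding_reverse_quarter_turns (C : Category) (I : C)
    (v h : Monoidal I) (T : TwoMonoidal v h)
    (h'v' : Interchange (reverse (forget_assoc h)) (reverse (forget_assoc v)))
    (v'h : Interchange (reverse (forget_assoc v)) (forget_assoc h)) (a b : C) :
  two_monoidal_braiding T b a = quarter_turn v'h a b ∘ quarter_turn h'v' a b.
Proof.
unfold two_monoidal_braiding, quarter_turn; simpl.
rewrite !comp_assoc.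
rewrite (eq_to_hom_irrelevant (interchange T I b a I) (inter_obj v'h a I I b)).
rewrite (eq_to_hom_irrelevant (eq_sym (interchange T b I I a))
           (inter_obj h'v' a I I b)).
reflexivity.
Qed.

Theorem theorem3p1 (C : ThreeMonoidalCategory) (a b : C) :
  gamma b a ∘ gamma a b = idm (a ⊗[tm_h C] b).
Proof.
pose proof (two_monoidal_interchange (tm_vh C)) as vh.
pose proof (two_monoidal_interchange (tm_dh C)) as dh.
pose proof (two_monoidal_interchange (tm_dv C)) as dv.
pose proof (Interchange_sym vh) as hv.
pose proof (Interchange_sym dh) as hd.
pose proof (Interchange_sym dv) as vd.
pose proof (Interchange_reverse_r vh) as vh'.
pose proof (Interchange_reverse_r dh) as dh'.
pose proof (Interchange_sym dh') as h'd.
pose proof (Interchange_reverse_l vh) as v'h.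
pose proof (Interchange_reverse_l (Interchange_reverse_r hv)) as h'v'.
pose proof (Interchange_reverse_l vd) as v'd.
unfold gamma.
rewrite (two_monoidal_braiding_quarter_turns (tm_vh C) hv vh' a b).
rewrite (two_monoidal_braiding_reverse_quarter_turns (tm_vh C) h'v' v'h a b).
rewrite (quarter_turn_path hv vh' hd dh' vd).
rewrite (quarter_turn_path h'v' v'h h'd dh v'd).
rewrite comp_assoc.
rewrite <- (comp_assoc _ (quarter_turn h'd a b) (quarter_turn dh' a b)).
rewrite quarter_turn_inverse, comp_idr.
exact (quarter_turn_inverse hd dh a b).
Qed.
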